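(* Let $N\ge 1$ be an integer and let $p,r,\theta,q,q^{\ast}$ be real numbers with $$p,r>1,\qquad 0\le\theta\le1,\qquad \frac{1}{q^{\ast}}=\theta\Big(\frac1p-\frac1N\Big)+\frac{1-\theta}{r},\qquad q>q^{\ast}>1.$$ Then the variational problem $$K:=\inf\Big\{\|u\|_{D^{1,p}}^{\theta}\,\|u\|_{\ell^r}^{1-\theta}:\ u\in D_0^{1,p}(\mathbb{Z}^N),\ \|u\|_{\ell^q}=1\Big\}$$ admits a minimizer, i.e. there is $u\in D_0^{1,p}(\mathbb{Z}^N)$ with $\|u\|_{\ell^q}=1$ and $\|u\|_{D^{1,p}}^{\theta}\|u\|_{\ell^r}^{1-\theta}=K$.
   Context: $\mathbb{Z}^N$ denotes the integer lattice graph: the vertices are the points of $\mathbb{Z}^N$, and $x\sim y$ (neighbors) iff $\sum_{i=1}^N|x_i-y_i|=1$. For a function $u$ on $\mathbb{Z}^N$, $\|u\|_{\ell^s}=\big(\sum_{x\in\mathbb{Z}^N}|u(x)|^s\big)^{1/s}\in[0,\infty]$ and $\|u\|_{D^{1,p}}=\big(\sum_{x\in\mathbb{Z}^N}\sum_{y\sim x}|u(y)-u(x)|^p\big)^{1/p}$. The space $D_0^{1,p}(\mathbb{Z}^N)$ is the completion of the space of finitely supported functions on $\mathbb{Z}^N$ in the norm $\|\cdot\|_{D^{1,p}}$. A factor raised to the power $0$ (i.e. when $\theta=0$ or $\theta=1$) is omitted, i.e. equals $1$. *)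

(* Defs.v *)
From HB Require Import structures.
From mathcomp Require Import all_boot all_order all_algebra.
From mathcomp Require Import all_classical all_reals all_analysis.

Set Implicit Arguments.
Unset Strict Implicit.
Unset Printing Implicit Defensive.

Import Order.TTheory GRing.Theory Num.Theory.
Import numFieldNormedType.Exports.

Local Open Scope classical_set_scope.
Local Open Scope ring_scope.

Section LatticeSpaces.
Context {R : realType} {N : nat}.

Definition lattice_adj (x y : 'rV[int]_N) : bool :=
  \sum_(i < N) `|x 0 i - y 0 i| == 1.

(* The norms take values in [0, +oo]; for s, p > 0, [+oo `^ s^-1 = +oo]. *)
Definition lnorm (s : R) (u : 'rV[int]_N -> R) : \bar R :=
  ((\esum_(x in [set: 'rV[int]_N]) (`|u x| `^ s)%:E) `^ s^-1)%E.

Definition Dnorm (p : R) (u : 'rV[int]_N -> R) : \bar R :=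
  ((\esum_(x in [set: 'rV[int]_N])
      \esum_(y in [set y | lattice_adj x y]) (`|u y - u x| `^ p)%:E) `^ p^-1)%E.

Definition finitely_supported (u : 'rV[int]_N -> R) : Prop :=
  finite_set [set x | u x != 0].

(* The completion of the finitely supported functions in [Dnorm p], realized
   as a space of functions: limits, both in [Dnorm p] and pointwise, of
   finitely supported functions.  For p < N, point evaluations are continuous
   for [Dnorm p] and this is exactly the completion.  For p >= N constants are
   limits of functions whose [Dnorm p] tends to 0, so an element of the abstract
   completion is a function up to an additive constant and [D0 p] contains all
   its representatives; at most one of them has finite l^q norm, q < +oo. *)
Definition D0 (p : R) : set ('rV[int]_N -> R) :=
  [set u | exists v : nat -> 'rV[int]_N -> R,
    [/\ forall n, finitely_supported (v n),
        forall x, v n x @[n --> \oo] --> u x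
      & Dnorm p (v n \- u) @[n --> \oo] --> 0%E]].

(* [a `^ 0 = 1] for every extended real [a] (also 0 and +oo), so a factor with
   exponent 0 is omitted.  The product 0 * +oo does not arise when
   [lnorm q u = 1], since then u is not constant and [Dnorm p u] is nonzero. *)
Definition energy (p r theta : R) (u : 'rV[int]_N -> R) : \bar R :=
  (Dnorm p u `^ theta * lnorm r u `^ (1 - theta))%E.

Definition admissible (p q : R) : set ('rV[int]_N -> R) :=
  [set u | D0 p u /\ lnorm q u = 1%E].

End LatticeSpaces.

Definition Kinf (R : realType) (N : nat) (p r theta q : R) : \bar R :=
  ereal_inf [set energy p r theta u | u in @admissible R N p q].

(* Main.v *)
Require Import Defs.
From HB Require Import structures.
From mathcomp Require Import all_boot all_order all_algebra.
From mathcomp Require Import finmap.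
From mathcomp Require Import all_classical all_reals all_analysis.
From mathcomp Require Import ring lra.

(** Along a minimizing sequence [w n], normalized by [lnorm q (w n) = 1], two
    things could prevent a limit from being a minimizer: the mass could spread
    out, or it could split into pieces that drift apart.

    Spreading is excluded because [q > q*].  Compare [u] with its values on a
    cube of side [M]: as [lnorm q u <= 1], for a suitable [M] of order
    [t^(-q/N)], at least half of the points of any such cube carry values at
    most [t/2] ([card_superlevel]).  Hence a point where [|u| > t] sees
    differences at least [t/2] at half of the shifts by cube vectors, and the
    number of such points is at most a constant times
    [t^(-p(1 + q/N)) * Dnorm p u ^ p] ([superlevel_gradient_bound]).  It is also at
    most [t^(-r) * lnorm r u ^ r].  The geometric mean of both bounds with the
    weights of the energy is [C * energy^s * t^(-sg)], where
    [1/s = theta/p + (1 - theta)/r] and [sg = s(1 + theta q/N)], and [sg < q] says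
    exactly that [q > q*].  If [|u| <= d], summing over dyadic levels gives
    [1 = lnorm q u ^ q <= C' * d^(q - sg)], so [d] is bounded below in terms of the
    energy ([nonvanishing]).

    After a translation, [|w n 0|] is therefore bounded below, and so are
    [Dnorm p (w n)] and [lnorm r (w n)].  As the energies are bounded, both norms
    are also bounded above.  Limits are taken along an ultrafilter on [nat] finer
    than [\oo], so that the values of [w n], its norms and those of its remainders,
    all bounded, converge simultaneously.  Let [u] be the pointwise limit.

    Splitting is excluded by strict concavity.  The Brezis-Lieb lemma, applied to
    [w n] and to its gradient, shows that [lnorm q ^ q], [Dnorm p ^ p] and
    [lnorm r ^ r] split additively between [u] and [w n - u].  Both parts satisfy
    [K * lnorm q v <= energy v] ([Kinf_scaling]).  The number [a = lnorm q u ^ q] is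
    positive because [u 0] is not 0; if it were less than [1], the weighted AM-GM
    inequality would give
    [a^(s/q) + (1 - a)^(s/q) <= 1], which is false because [s < q]
    ([powR_prod_split]).  So [a = 1], and [u] is a minimizer by Fatou's lemma.

    Membership in [D0 p] is automatic for functions of finite [lnorm q] and
    [Dnorm p], by soft thresholding ([D0_of_finite]).  If [theta = 0], or if
    the infimum is infinite, the indicator of the origin is a minimizer.  If
    [theta = 1], the energy does not depend on [r], and [r = q] makes
    [lnorm r] finite. *)

Set Implicit Arguments.
Unset Strict Implicit.
Unset Printing Implicit Defensive.

Import Order.TTheory GRing.Theory Num.Theory.
Import numFieldNormedType.Exports.

Local Open Scope classical_set_scope.
Local Open Scope ring_scope.

(** * Real powers *)

Section PowerReals.
Context {R : realType}.
Implicit Types a b s t x M : R.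

(** Convexity of the power, for [a + b] written as the mean of [a / (1 - t)] and
    [b / t].  It replaces Minkowski's inequality below: with [t] small it is the
    splitting inequality behind the Brezis-Lieb lemma, and with [t = 1/(n+1)] it
    adds up [n + 1] increments without loss. *)
Lemma powR_add_le s t a b : 1 <= s -> 0 < t < 1 ->
  `|a + b| `^ s <= (1 - t) `^ (1 - s) * `|a| `^ s + t `^ (1 - s) * `|b| `^ s.
Proof.
move=> s1 /andP[t0 t1]; have t'0 : 0 < 1 - t by rewrite subr_gt0.
have s0 : 0 < s by exact: lt_le_trans s1.
have div (c : R) (x : R) : 0 < c -> c * (`|x| / c) `^ s = c `^ (1 - s) * `|x| `^ s.
  move=> c0; rewrite powRB; last by apply/implyP => _; rewrite gt_eqF.
  rewrite powRM ?normr_ge0 ?invr_ge0 ?(ltW c0)// powRr1 ?(ltW c0)//.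
  by rewrite -powR_inv1 ?(ltW c0)// powRAC powR_inv1 ?powR_ge0//; ring.
have := @convex_powR R s s1 (Itv01 (ltW t0) (ltW t1)) (`|b| / t) (`|a| / (1 - t)).
rewrite !inE /= !in_itv /= !andbT !divr_ge0 ?(ltW t0) ?(ltW t'0)//.
move=> /(_ isT isT); rewrite convRE [X in X `^ _ <= _ -> _]convRE /= /unstable.onem.
rewrite !div// [t * _]mulrC [(1 - t) * (_ / _)]mulrC !divfK ?gt_eqF//.
rewrite [X in _ <= X]addrC; apply: le_trans.
apply: ge0_ler_powR; rewrite ?nnegrE ?addr_ge0 ?(ltW s0)//.
by rewrite addrC ler_normD.
Qed.

Lemma cvg_powR {I : Type} (F : set_system I) {FF : Filter F} (f : I -> R) a s :
  0 <= s -> (forall i, 0 <= f i) -> f i @[i --> F] --> a -> f i `^ s @[i --> F] --> a `^ s.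
Proof.
rewrite le_eqVlt => /predU1P[<-|s0] f0 fa.
  rewrite powRr0; under eq_fun do rewrite powRr0.
  exact: cvg_cst.
have [aneq0|a0] := eqVneq a 0.
  rewrite aneq0 powR0 ?gt_eqF//; apply/cvgrPdist_lt => e e0.
  have := fa; rewrite aneq0 => /cvgrPdist_lt/(_ (e `^ s^-1)).
  rewrite powR_gt0// => /(_ isT); apply: filterS => i.
  rewrite !sub0r !normrN !ger0_norm ?powR_ge0// => fe.
  rewrite -(@powRr1 _ e) ?ltW// -(@mulVf _ s) ?gt_eqF// powRrM.
  by rewrite gt0_ltr_powR// nnegrE// powR_ge0.
case: (ltgtP a 0) => // [a_lt0|a_gt0|/eqP]; last by rewrite (negbTE a0).
  move: fa => /cvgrPdist_lt/(_ (- a)); rewrite oppr_gt0 => /(_ a_lt0) H.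
  apply/cvgrPdist_lt => e e0; apply: filterS H => i.
  rewrite ltr_norml opprK => /andP[]; have := f0 i; lra.
apply: (@cvg_comp _ _ _ f (@powR R ^~ s) F (nbhs a)) => //; have := @derivable_powR R 1 s a.
rewrite in_itv /= a_gt0 => /(_ isT) /derivable1_diffP/differentiable_continuous.
exact.
Qed.

Lemma powR_ge1 a s : 1 <= a -> 0 <= s -> 1 <= a `^ s.
Proof. by move=> a1 s0; rewrite -(powRr0 a) ler_powR. Qed.

Lemma powR_le1 a s : 0 < a <= 1 -> 0 <= s -> a `^ s <= 1.
Proof. by move=> a1 s0; rewrite -(powRr0 a) ger_powR. Qed.

Lemma powR_bound x a M : 0 <= x -> 0 < a -> x `^ a <= M -> x <= M `^ a^-1.
Proof.
move=> x0 a0 xM; rewrite -[x in x <= _](powRr1 x0) -(@divff _ a) ?gt_eqF// powRrM.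
apply: ge0_ler_powR; rewrite ?nnegrE ?invr_ge0 ?powR_ge0 ?(ltW a0)//.
exact: le_trans (powR_ge0 _ _) xM.
Qed.

(** The first constant of [powR_add_le] can be brought as close to 1 as desired. *)
Lemma near_one_powR (s e : R) : 1 < s -> 0 < e ->
  exists2 t, 0 < t < 1 & (1 - t) `^ (1 - s) = 1 + e.
Proof.
move=> s1 e0; have e1 : 0 < 1 + e by lra.
have s'0 : 0 < s - 1 by rewrite subr_gt0.
have x0 : 0 < (1 + e) `^ (1 - s)^-1 by rewrite powR_gt0.
have x1 : (1 + e) `^ (1 - s)^-1 < 1.
  rewrite -opprB invrN powRN invf_lt1 ?powR_gt0//.
  have {1}<- : (1 : R) `^ (s - 1)^-1 = 1 by rewrite powR1.
  by apply: gt0_ltr_powR; rewrite ?invr_gt0 ?nnegrE//; lra.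
exists (1 - (1 + e) `^ (1 - s)^-1); first by apply/andP; split; lra.
by rewrite subKr -powRrM mulVf ?powRr1 ?ltW// lt_eqF// subr_lt0.
Qed.
End PowerReals.

Section MeanInequalities.
Context {R : realType}.
Implicit Types x y a b c : R.

(** Young's inequality, extended to the weights 0 and 1, where [x `^ 0 = 1]. *)
Lemma weighted_amgm x y l : 0 <= x -> 0 <= y -> 0 <= l <= 1 ->
  x `^ l * y `^ (1 - l) <= l * x + (1 - l) * y.
Proof.
move=> x0 y0 /andP[]; rewrite le_eqVlt => /predU1P[<- _|l0].
  by rewrite powRr0 subr0 powRr1// !mul1r mul0r add0r.
rewrite le_eqVlt => /predU1P[->|l1].
  by rewrite subrr powRr0 powRr1// mulr1 mul1r mul0r addr0.
have l'0 : 0 < 1 - l by rewrite subr_gt0.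
have := @conjugate_powR R (x `^ l) (y `^ (1 - l)) l^-1 (1 - l)^-1.
rewrite !powR_ge0 !invr_gt0 !invrK => /(_ isT isT l0 l'0 (subrKC _ _)).
by rewrite -!powRrM !mulfV ?gt_eqF// !powRr1// mulrC [_ * (1 - l)]mulrC [x * l]mulrC mulrC.
Qed.

Lemma lt_powR_exp x e : 0 < x < 1 -> e < 1 -> x < x `^ e.
Proof.
move=> /andP[x0 x1] e1; rewrite /powR gt_eqF// -{1}(lnK x0) ltr_expR.
have lnx : ln x < 0 by rewrite ln_lt0// x0.
by rewrite -subr_gt0 -{2}(mul1r (ln x)) -mulrBl nmulr_lgt0// subr_lt0.
Qed.

(** Strict concavity.  With [l = al / (al + be)], AM-GM bounds
    [(X1/X)^l * (Y1/Y)^(1-l)] by [l X1/X + (1-l) Y1/Y], and the same expressions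
    with index 2 add up with these to 1.  The two hypotheses therefore
    give [a^e + (1-a)^e <= 1] with [e = c / (al + be) < 1], whereas [a < a^e]
    for [a] in (0, 1). *)
Lemma powR_prod_split al be c a X1 X2 Y1 Y2 :
  0 <= al -> 0 <= be -> 0 < c < al + be -> 0 < a < 1 ->
  0 <= X1 -> 0 <= X2 -> 0 <= Y1 -> 0 <= Y2 -> 0 < X1 + X2 -> 0 < Y1 + Y2 ->
  (X1 + X2) `^ al * (Y1 + Y2) `^ be * a `^ c <= X1 `^ al * Y1 `^ be ->
  (X1 + X2) `^ al * (Y1 + Y2) `^ be * (1 - a) `^ c <= X2 `^ al * Y2 `^ be ->
  False.
Proof.
move=> al0 be0 /andP[c0 cm] /andP[a0 a1] X10 X20 Y10 Y20 X0 Y0.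
set X := X1 + X2 in X0 *; set Y := Y1 + Y2 in Y0 *; set m := al + be in cm.
have m0 : 0 < m by exact: lt_trans cm.
pose l := al / m.
have l01 : 0 <= l <= 1.
  by rewrite divr_ge0 ?(ltW m0)//= /l ler_pdivrMr// mul1r lerDl.
have l' : 1 - l = be / m.
  by rewrite /l /m; field; rewrite -/m gt_eqF.
have key b X3 Y3 : 0 < b < 1 -> 0 <= X3 -> 0 <= Y3 ->
  X `^ al * Y `^ be * b `^ c <= X3 `^ al * Y3 `^ be ->
  b < l * (X3 / X) + (1 - l) * (Y3 / Y).
  move=> b01 X30 Y30 h; have /andP[b0 b1] := b01.
  have cm1 : c / m < 1 by rewrite ltr_pdivrMr// mul1r.
  apply: lt_le_trans (lt_powR_exp b01 cm1) _.
  have x0 : 0 <= X3 / X by rewrite divr_ge0// ltW.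
  have y0 : 0 <= Y3 / Y by rewrite divr_ge0// ltW.
  apply: le_trans (weighted_amgm x0 y0 l01).
  rewrite l' !powRrM -powRM ?powR_ge0//.
  apply: ge0_ler_powR; rewrite ?nnegrE ?mulr_ge0 ?invr_ge0 ?powR_ge0 ?(ltW m0)//.
  have XY0 : 0 < X `^ al * Y `^ be by rewrite mulr_gt0// powR_gt0.
  rewrite -(ler_pM2l XY0) (le_trans h)// le_eqVlt; apply/orP; left; apply/eqP.
  rewrite mulrACA -!powRM ?(ltW X0) ?(ltW Y0)//.
  by rewrite ![_ * (_ / _)]mulrC !divfK ?gt_eqF.
move=> h1 h2.
have a'01 : 0 < 1 - a < 1 by apply/andP; split; lra.
have := key _ _ _ _ X10 Y10 h1; rewrite a0 a1 => /(_ isT) k1.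
have k2 := key _ _ _ a'01 X20 Y20 h2.
have := ltrD k1 k2; rewrite addrACA -!mulrDr -!mulrDl -/X -/Y !divff ?gt_eqF//.
lra.
Qed.

End MeanInequalities.

(** * Sums of powers over a discrete set *)

Section PowerSums.
Context {R : realType} {T : choiceType}.
Implicit Types (f g h : T -> R) (F G : {fset T}) (s a b c : R).

Definition psum s f : \bar R :=
  (\esum_(x in [set: T]) (`|f x| `^ s)%:E)%E.

Definition fsum F s f : R := \sum_(x <- F) `|f x| `^ s.

Lemma fsum_ge0 F s f : 0 <= fsum F s f.
Proof. by apply: sumr_ge0 => i _; exact: powR_ge0. Qed.

Lemma psum_ge0 s f : (0 <= psum s f)%E.
Proof. by apply: esum_ge0 => x _; rewrite lee_fin powR_ge0. Qed.

Lemma psum_leP s f a : (psum s f <= a%:E)%E <-> forall F, fsum F s f <= a.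
Proof.
split=> [fa F|fa].
  rewrite -lee_fin (le_trans _ fa)//; apply: ereal_sup_ubound.
  exists [set` F]; first by split.
  by rewrite fsbig_finite//= set_fsetK sumEFin.
apply: ge_ereal_sup => _ [A [finA _] <-].
by rewrite fsbig_finite//= sumEFin lee_fin fa.
Qed.

Lemma psum_fin s f a : (psum s f <= a%:E)%E ->
  exists2 b, psum s f = b%:E & 0 <= b <= a.
Proof.
have := psum_ge0 s f; case: (psum s f) => // b b0 ba.
by exists b; rewrite // -!lee_fin b0.
Qed.

Lemma fsum_le F s f a : psum s f = a%:E -> fsum F s f <= a.
Proof. by move=> fa; move: F; apply/psum_leP; rewrite fa. Qed.

Lemma fsum_cofinal s f a e : psum s f = a%:E -> 0 < e ->
  exists F, a - e < fsum F s f.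
Proof.
move=> fa e0; apply/not_existsP => h.
have : (psum s f <= (a - e)%:E)%E.
  by apply/psum_leP => F; rewrite leNgt; apply/negP; exact: h.
by rewrite fa lee_fin; lra.
Qed.

Lemma fsum_subset F G s f : (F `<=` G)%fset -> fsum F s f <= fsum G s f.
Proof.
move=> FG; rewrite /fsum (big_fsetID _ (mem F) G)/=.
have -> : [fset x in G | x \in F]%fset = F.
  by apply/fsetP => x; rewrite !inE /= andbC; case: (boolP (x \in F)) => // /(fsubsetP FG) ->.
by rewrite lerDl sumr_ge0// => i _; rewrite powR_ge0.
Qed.

Lemma fsumU F G s f : fsum (F `|` G)%fset s f = fsum F s f + fsum (G `\` F)%fset s f.
Proof.
rewrite /fsum (big_fsetID _ (mem F) (F `|` G)%fset)/=; congr (_ + _).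
  by apply: eq_fbigl => x; rewrite !inE /= andbC; case: (x \in F).
by apply: eq_fbigl => x; rewrite !inE /=; case: (x \in F); rewrite ?andbT ?andbF.
Qed.

(** A pointwise bound is used only outside the finite set [F]; on [F] the sum of
    [f] is kept as it is.  This lets limits be taken on [F] while the tails of
    [g] and [h] stay under control. *)
Lemma psum_le_tail s f g h F a b c1 c2 : psum s g = a%:E -> psum s h = b%:E ->
  0 <= c1 -> 0 <= c2 ->
  (forall x, `|f x| `^ s <= c1 * `|g x| `^ s + c2 * `|h x| `^ s) ->
  (psum s f <= (fsum F s f + c1 * (a - fsum F s g) + c2 * (b - fsum F s h))%:E)%E.
Proof.
move=> ga hb c10 c20 fgh; apply/psum_leP => G.
apply: (le_trans (fsum_subset _ _ (fsubsetUr F G))); rewrite fsumU -addrA lerD2l.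
apply: (@le_trans _ _ (c1 * fsum (G `\` F)%fset s g + c2 * fsum (G `\` F)%fset s h)).
  by rewrite /fsum !mulr_sumr -big_split ler_sum.
by apply: lerD; rewrite ler_wpM2l// lerBrDl -fsumU; exact: fsum_le.
Qed.

Lemma psum_le_lin s f g h a b c1 c2 : psum s g = a%:E -> psum s h = b%:E ->
  0 <= c1 -> 0 <= c2 ->
  (forall x, `|f x| `^ s <= c1 * `|g x| `^ s + c2 * `|h x| `^ s) ->
  (psum s f <= (c1 * a + c2 * b)%:E)%E.
Proof.
move=> ga hb c10 c20 fgh.
have := psum_le_tail fset0 ga hb c10 c20 fgh.
by rewrite /fsum !big_seq_fset0 add0r !subr0.
Qed.

Lemma psumN s f : psum s (fun x => - f x) = psum s f.
Proof. by apply: eq_esum => x _; rewrite normrN. Qed.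

Lemma psumZ s f c a : c != 0 -> psum s f = a%:E ->
  psum s (fun x => c * f x) = (`|c| `^ s * a)%:E.
Proof.
have le (k : R) g b : psum s g = b%:E -> (psum s (fun x => (k * g x)%R) <= (`|k| `^ s * b)%:E)%E.
  move=> gb; apply/psum_leP => F; rewrite /fsum.
  under eq_bigr do rewrite normrM powRM ?normr_ge0//.
  by rewrite -mulr_sumr ler_wpM2l ?powR_ge0//; exact: fsum_le.
move=> c0 fa; have [b cfb _] := psum_fin (le c _ _ fa).
apply/eqP; rewrite eq_le le//= cfb lee_fin.
have := le c^-1 _ _ cfb.
rewrite [X in psum s X](_ : _ = f); last by apply/funext => x; rewrite mulKf.
rewrite fa lee_fin => /(ler_wpM2l (powR_ge0 `|c| s)); rewrite mulrA -powRM ?normr_ge0//.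
by rewrite -normrM divff// normr1 powR1 mul1r.
Qed.

Lemma psum_pointwise s f a x : psum s f = a%:E -> `|f x| `^ s <= a.
Proof.
by move=> /(fsum_le [fset x]%fset); rewrite /fsum big_seq_fset1.
Qed.

Lemma psum_gt0 s f x : f x != 0 -> (0 < psum s f)%E.
Proof.
move=> fx; rewrite lt_neqAle psum_ge0 andbT; apply/eqP => /esym/psum_pointwise => /(_ x).
by apply/negP; rewrite -ltNge powR_gt0 ?normr_gt0.
Qed.

Lemma psum_neq0_ex s f : s != 0 -> psum s f != 0%E ->
  exists x, f x != 0.
Proof.
move=> s0 f0; apply/not_existsP => h; move/negP: f0; apply; apply/eqP.
by apply: esum1 => x _; have /negP := h x; rewrite negbK => /eqP ->; rewrite normr0 powR0.
Qed.

End PowerSums.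

Section Injections.
Context {R : realType} {T T' : choiceType}.

Lemma psum_inj (s : R) (j : T -> T') (g : T' -> R) : injective j ->
  (psum s (g \o j) <= psum s g)%E.
Proof.
move=> jI; case E: (psum s g) => [a||]; first last.
- by have := psum_ge0 s g; rewrite E.
- exact: leey.
apply/psum_leP => F.
have -> : fsum F s (g \o j) = fsum [fset j x | x in F]%fset s g.
  by rewrite /fsum big_imfset//= => x y _ _; exact: jI.
exact: fsum_le.
Qed.

End Injections.

Lemma psum_bij {R : realType} {T T' : choiceType} (s : R) (j : T -> T') j' (g : T' -> R) :
  cancel j j' -> cancel j' j -> psum s (g \o j) = psum s g.
Proof.
move=> jK j'K; apply/eqP; rewrite eq_le (psum_inj s g (can_inj jK)) /=.
have := psum_inj s (g \o j) (can_inj j'K).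
by rewrite [X in psum s X](_ : _ = g)//; apply/funext => x /=; rewrite j'K.
Qed.

(** * Limits of sums of powers *)

Section BrezisLieb.
Context {R : realType}.

(** An ultrafilter contains the preimage of a neighbourhood of a cluster point or
    its complement, and the complement is incompatible with clustering; compactness
    of the interval gives a cluster point. *)
Lemma ultra_bounded_cvg {I : Type} (U : set_system I) {UU : UltraFilter U}
    (f : I -> R) (M : R) : (forall i, `|f i| <= M) ->
  exists l : R, f i @[i --> U] --> l.
Proof.
move=> fM; have := @segment_compact R (- M) M.
move=> /(_ (fmap f U) (fmap_proper_filter f _))[].
  by apply: (@filterE _ U) => i; rewrite /= in_itv /= -ler_norml.
move=> l [_ cl]; exists l => A lA.
have [//|UA] := in_ultra_setVsetC (f @^-1` A) UU.
have [x []] := cl (~` A) A UA lA.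
by [].
Qed.

Section Sequence.
Context {T : choiceType} (U : set_system nat) {UU : ProperFilter U}.
Context (s : R) (f_ : nat -> T -> R) (f : T -> R).
Context (f_f : forall x, f_ i x @[i --> U] --> f x).

Lemma cvg_fsum F : 0 <= s -> fsum F s (f_ i) @[i --> U] --> fsum F s f.
Proof.
move=> s0; apply: cvg_big => [|x _]; first exact: add_continuous.
by apply: cvg_powR => // ; exact: cvg_norm.
Qed.

Lemma cvg_fsumB F : 0 < s -> fsum F s (f_ i \- f) @[i --> U] --> (0 : R).
Proof.
move=> s0; rewrite [X in _ --> X](_ : _ = \sum_(x <- F) (0 : R)); last by rewrite big1.
apply: cvg_big => [|x _]; first exact: add_continuous.
rewrite -[X in _ --> X](powR0 (lt0r_neq0 s0)).
apply: cvg_powR => //; first exact: ltW.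
rewrite -[X in _ --> X](@normr0 _ R); apply: cvg_norm.
rewrite -[X in _ --> X](subrr (f x)); apply: cvgB => //; exact: cvg_cst.
Qed.

Lemma psum_fatou (A : nat -> R) a : 0 <= s -> (forall i, psum s (f_ i) = (A i)%:E) ->
  A i @[i --> U] --> a -> (psum s f <= a%:E)%E.
Proof.
move=> s0 fA Aa; apply/psum_leP => F.
apply: (ler_cvg_to (@cvg_fsum F s0) Aa).
by apply: nearW => i; exact: fsum_le.
Qed.

(** Outside a large finite set [f] is negligible, so there [f_ n] and [f_ n - f]
    have nearly the same power sum, by [powR_add_le] used in both directions.  On the
    finite set [f_ n] converges to [f]. *)
Lemma brezis_lieb (A B : nat -> R) a b c : 1 < s ->
  (forall i, psum s (f_ i) = (A i)%:E) ->
  (forall i, psum s (f_ i \- f) = (B i)%:E) -> psum s f = c%:E ->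
  A i @[i --> U] --> a -> B i @[i --> U] --> b -> a = c + b.
Proof.
move=> s1 fA fB fc Aa Bb.
have s0 : 0 < s by lra.
have c0 : 0 <= c by rewrite -lee_fin -fc psum_ge0.
have fNc : psum s (fun x => - f x) = c%:E by rewrite psumN.
have b0 : 0 <= b.
  by apply: (cvgr_to_ge Bb); apply: nearW => i; rewrite -lee_fin -fB psum_ge0.
have ac : c <= a by rewrite -lee_fin -fc; exact: psum_fatou (ltW s0) fA Aa.
(* It suffices to prove both inequalities up to a factor [1 + e]. *)
suff H e : 0 < e -> a <= c + (1 + e) * b /\ b <= (1 + e) * (a - c).
  apply/eqP; rewrite eq_le; apply/andP; split.
    apply/ler_addgt0Pr => e e0; have b1 : 0 < b + 1 by lra.
    have [+ _] := H (e / (b + 1)) (divr_gt0 e0 b1).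
    have : e / (b + 1) * b <= e by rewrite mulrAC ler_pdivrMr// ler_pM2l//; lra.
    lra.
  apply/ler_addgt0Pr => e e0; have a1 : 0 < a - c + 1 by lra.
  have [_] := H (e / (a - c + 1)) (divr_gt0 e0 a1).
  have : e / (a - c + 1) * (a - c) <= e by rewrite mulrAC ler_pdivrMr// ler_pM2l//; lra.
  lra.
move=> e0; have [t t01 te] := near_one_powR s1 e0.
set k := t `^ (1 - s).
have k0 : 0 <= k by exact: powR_ge0.
have e1 : 0 <= 1 + e by lra.
have pw (u v : R) : `|u + v| `^ s <= (1 + e) * `|u| `^ s + k * `|v| `^ s.
  by rewrite -te; apply: powR_add_le => //; exact: ltW.
have tail F : a <= fsum F s f + (1 + e) * b + k * (c - fsum F s f) /\
    b <= (1 + e) * (a - fsum F s f) + k * (c - fsum F s f).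
  split.
    have L : fsum F s (f_ i) + (1 + e) * (B i - fsum F s (f_ i \- f))
         + k * (c - fsum F s f) @[i --> U] -->
         fsum F s f + (1 + e) * (b - 0) + k * (c - fsum F s f).
      apply: cvgD; last exact: cvg_cst.
      apply: cvgD; first exact: cvg_fsum (ltW s0).
      by apply: cvgMl_tmp; apply: cvgB => //; exact: cvg_fsumB.
    rewrite subr0 in L; apply: (ler_cvg_to Aa L); apply: nearW => i.
    rewrite -lee_fin -fA; apply: (psum_le_tail F (fB i) fc e1 k0) => x.
    by rewrite -[in leLHS](subrK (f x) (f_ i x)); exact: pw.
  have L : fsum F s (f_ i \- f) + (1 + e) * (A i - fsum F s (f_ i))
       + k * (c - fsum F s f) @[i --> U] -->
       0 + (1 + e) * (a - fsum F s f) + k * (c - fsum F s f).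
    apply: cvgD; last exact: cvg_cst.
    apply: cvgD; first exact: cvg_fsumB.
    by apply: cvgMl_tmp; apply: cvgB => //; exact: cvg_fsum (ltW s0).
  rewrite add0r in L; apply: (ler_cvg_to Bb L); apply: nearW => i.
  rewrite -lee_fin -fB; apply: (psum_le_tail F (fA i) fc e1 k0) => x.
  by rewrite -(normrN (f x)); exact: pw.
have K0 : 0 < 1 + e + k by lra.
split; apply/ler_addgt0Pr => d d0.
all: have [F] := fsum_cofinal fc (divr_gt0 d0 K0).
all: have [T1 T2] := tail F.
all: have Fc := fsum_le F fc.
all: set S := fsum F s f in T1 T2 Fc *.
all: move=> h; have h' : (1 + e + k) * (c - S) <= d
  by rewrite mulrC -ler_pdivlMr//; lra.
all: have kc : 0 <= k * (c - S) by rewrite mulr_ge0// subr_ge0.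
all: have ec : 0 <= e * (c - S) by rewrite mulr_ge0// ?subr_ge0// ltW.
all: lra.
Qed.

End Sequence.
(** The Brezis-Lieb lemma in the form in which it is applied: along an ultrafilter
    the limits exist by boundedness. *)
Lemma ultra_psumB (U : set_system nat) {UU : UltraFilter U} {T : choiceType} (s : R)
    (f_ : nat -> T -> R) (f : T -> R) (A : nat -> R) (a M : R) : 1 < s ->
  (forall x, f_ n x @[n --> U] --> f x) ->
  (forall n, psum s (f_ n) = (A n)%:E) -> (forall n, A n <= M) -> A n @[n --> U] --> a ->
  exists c B b, [/\ psum s f = c%:E, (forall n, psum s (f_ n \- f) = (B n)%:E),
     B n @[n --> U] --> b, 0 <= c /\ 0 <= b & a = c + b].
Proof.
move=> s1 ff fA AM Aa; have s0 : 0 < s by lra.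
have [c fc /andP[c0 _]] := psum_fin (psum_fatou ff (ltW s0) fA Aa).
have t01 : 0 < (2^-1 : R) < 1 by rewrite invr_gt0 invf_lt1// ltr1n ltr0n.
set k1 := (1 - 2^-1 : R) `^ (1 - s); set k2 := (2^-1 : R) `^ (1 - s).
have k10 : 0 <= k1 by exact: powR_ge0.
have k20 : 0 <= k2 by exact: powR_ge0.
have bd n : (psum s (f_ n \- f)%R <= (k1 * M + k2 * c)%:E)%E.
  have h x : `|(f_ n \- f) x| `^ s <= k1 * `|f_ n x| `^ s + k2 * `|f x| `^ s.
    by rewrite /= -(normrN (f x)); exact: powR_add_le (ltW s1) t01.
  apply: (le_trans (psum_le_lin (fA n) fc k10 k20 h)).
  by rewrite lee_fin lerD2r ler_wpM2l.
have fin n : exists b : R, psum s (f_ n \- f) = b%:E /\ `|b| <= k1 * M + k2 * c.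
  by have [b bE /andP[b0 bM]] := psum_fin (bd n); exists b; rewrite ger0_norm.
have [B BE] := choice fin.
have [b Bb] := ultra_bounded_cvg (U := U) (fun n => (BE n).2).
exists c, B, b; split => //.
- by move=> n; exact: (BE n).1.
- split=> //; apply: (cvgr_to_ge Bb); apply: nearW => n.
  by rewrite -lee_fin -(BE n).1 psum_ge0.
- by apply: (brezis_lieb ff s1 fA _ fc Aa Bb) => n; exact: (BE n).1.
Qed.

End BrezisLieb.

(** Dominated convergence, with the tails of [g] bounding those of [f_ n]. *)
Lemma psum_dominated_cvg0 {R : realType} {T : choiceType} (s c : R)
    (f_ : nat -> T -> R) (g : T -> R) (A : nat -> R) : 0 < s ->
  psum s g = c%:E -> (forall n x, `|f_ n x| <= `|g x|) ->
  (forall x, f_ n x @[n --> \oo] --> (0 : R)) ->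
  (forall n, psum s (f_ n) = (A n)%:E) -> A n @[n --> \oo] --> (0 : R).
Proof.
move=> s0 gc fg f0 fA; apply/cvgrPdist_le => e e0.
have [F Fe] := fsum_cofinal gc (divr_gt0 e0 (ltr0n _ 2)).
have : fsum F s (f_ n) @[n --> \oo] --> fsum F s (fun=> 0 : R).
  by apply: cvg_fsum => //; exact: ltW.
have -> : fsum F s (fun=> 0 : R) = 0.
  by rewrite /fsum big1// => x _; rewrite normr0 powR0 ?gt_eqF.
move=> /cvgrPdist_le/(_ _ (divr_gt0 e0 (ltr0n _ 2))); apply: filterS => n.
rewrite !sub0r !normrN (ger0_norm (fsum_ge0 _ _ _)) => Fn.
have A0 : 0 <= A n by rewrite -lee_fin -fA psum_ge0.
rewrite ger0_norm// -lee_fin -fA.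
have fn x : `|f_ n x| `^ s <= 1 * `|g x| `^ s + 0 * `|g x| `^ s.
  by rewrite mul1r mul0r addr0; apply: ge0_ler_powR; rewrite ?nnegrE ?(ltW s0).
apply: (le_trans (psum_le_tail F gc gc ler01 (lexx 0) fn)); rewrite lee_fin; lra.
Qed.

(** * The discrete gradient *)

Section Lattice.
Context {R : realType} {N : nat}.
Local Notation V := 'rV[int]_N.
Implicit Types (u v : V -> R) (x y h : V) (p s : R).

(** Extended by 0 to all pairs of vertices, so that [Dnorm] becomes a power sum of a
    single function and the results on power sums apply to it ([DnormE]). *)
Definition grad u (e : V * V) : R :=
  if lattice_adj e.1 e.2 then u e.2 - u e.1 else 0.

Lemma DnormE p u : 0 < p -> Dnorm p u = (psum p (grad u) `^ p^-1)%E.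
Proof.
move=> p0; congr (_ `^ _)%E.
rewrite (esum_esum (a := fun x y => (`|u y - u x| `^ p)%:E)); last first.
  by move=> *; rewrite lee_fin powR_ge0.
rewrite esum_mkcond; apply: eq_esum => -[x y] _ /=; rewrite /grad /=.
case: ifPn => [|nadj].
  by rewrite inE /= => -[_ ->].
case: ifPn => [adj|_]; last by rewrite normr0 powR0 ?gt_eqF.
by move: nadj; rewrite notin_setE /= => /(_ (conj I adj)).
Qed.

Lemma lattice_adj_shift x h : lattice_adj x (x + h) = (\sum_(i < N) `|h 0 i| == 1).
Proof.
by rewrite /lattice_adj; congr (_ == _); apply: eq_bigr => i _; rewrite !mxE opprD addNKr normrN.
Qed.

Lemma lattice_adjD x y h : lattice_adj (x + h) (y + h) = lattice_adj x y.
Proof.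
rewrite /lattice_adj; congr (_ == _); apply: eq_bigr => i _; rewrite !mxE.
by congr `|_|; rewrite opprD addrACA subrr addr0.
Qed.

Lemma psum_translate s u h : psum s (fun x => u (x + h)) = psum s u.
Proof. exact: (psum_bij s u (addrK h) (subrK h)). Qed.

Lemma psum_grad_translate p u h : psum p (grad (fun x => u (x + h))) = psum p (grad u).
Proof.
pose j h (e : V * V) := (e.1 + h, e.2 + h).
have jK k : cancel (j k) (j (- k)) by case=> x y; rewrite /j /= !addrK.
rewrite -(psum_bij p (grad u) (jK h) (j' := j (- h))); last first.
  by have := jK (- h); rewrite opprK.
by congr psum; apply/funext => -[x y]; rewrite /grad /= lattice_adjD.
Qed.

(** The pairs [(x, x + e)] are distinct edges. *)
Lemma psum_unit_step p u (e : V) : \sum_(i < N) `|e 0 i| = 1 ->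
  (psum p (fun x => u (x + e)%R - u x)%R <= psum p (grad u))%E.
Proof.
move=> e1; have jI : injective (fun x => (x, x + e)) by move=> x y [].
have := psum_inj p (grad u) jI; congr (_ <= _)%E; congr psum.
by apply/funext => x; rewrite /grad /= lattice_adj_shift e1 eqxx.
Qed.

(** A shift by [n] unit steps costs at most [n] times the norm of the gradient.  The
    exponent of [n] has to be exactly [p], since it is what determines the critical
    exponent; hence the choice of [t = 1/(n+1)] in [powR_add_le]. *)
Lemma psum_shift p u (X : R) (es : seq V) : 1 <= p ->
  psum p (grad u) = X%:E -> {in es, forall e : V, \sum_(i < N) `|e 0 i| = 1} ->
  (psum p (fun x => u (x + \sum_(e <- es) e)%R - u x)%R <= ((size es)%:R `^ p * X)%:E)%E.
Proof.
move=> p1 uX; have p0 : 0 < p by lra.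
have X0 : 0 <= X by rewrite -lee_fin -uX psum_ge0.
elim: es => [|e [|e' es] IH] unit_es.
- apply/psum_leP => F; rewrite powR0 ?gt_eqF// mul0r /fsum big1// => x _.
  by rewrite big_nil addr0 subrr normr0 powR0 ?gt_eqF.
- by rewrite big_seq1 powR1 mul1r -uX; apply: psum_unit_step; apply: unit_es; rewrite inE.
have {}IH := IH (fun k kes => unit_es k (mem_behead (s := e :: _) kes)).
set es' := e' :: es in IH *; set n := size es' in IH *.
have [a fa /andP[_ aX]] := psum_fin IH.
have := @psum_unit_step p u e; rewrite uX => /(_ (unit_es _ (mem_head _ _))).
move=> /psum_fin[b gb /andP[_ bX]].
rewrite -(psum_translate _ _ (\sum_(k <- es') k)) in gb.
have n0 : 0 < n%:R :> R by rewrite ltr0n.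
have n1 : 0 < n%:R + 1 :> R by rewrite addr_gt0.
have t01 : 0 < (n%:R + 1 : R)^-1 < 1.
  by rewrite invr_gt0 n1 invf_lt1// ltrDr.
have t' : 1 - (n%:R + 1)^-1 = n%:R / (n%:R + 1) :> R.
  by field; rewrite gt_eqF.
have t0 := powR_ge0 (n%:R + 1 : R)^-1 (1 - p).
apply: (le_trans (psum_le_lin fa gb (powR_ge0 (1 - (n%:R + 1)^-1) (1 - p)) t0 _)).
  move=> x; rewrite big_cons [e + _]addrC addrA.
  set z := x + _; rewrite [in leLHS](_ : _ - _ = (u z - u x) + (u (z + e) - u z)).
    exact: powR_add_le.
  by ring.
rewrite lee_fin t' powRM ?invr_ge0 ?(ltW n0) ?(ltW n1)//=.
have -> : (n.+1%:R : R) = n%:R + 1 by rewrite natr1.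
have -> : (n%:R + 1)^-1 `^ (1 - p) = (n%:R + 1) `^ (p - 1) :> R.
  by rewrite -powR_inv1 ?(ltW n1)// -powRrM mulN1r opprB.
apply: (@le_trans _ _ (n%:R `^ (1 - p) * (n%:R + 1) `^ (p - 1) * (n%:R `^ p * X)
    + (n%:R + 1) `^ (p - 1) * X)).
  by apply: lerD; apply: ler_wpM2l.
rewrite [X in X + _](_ : _ =
  (n%:R + 1) `^ (p - 1) * X * (n%:R `^ (1 - p) * n%:R `^ p)); last by ring.
rewrite -powRD; last by rewrite (gt_eqF n0) implybT.
rewrite subrK powRr1 ?(ltW n0)//.
rewrite -(mulr_powRB1 (ltW n1) p0) le_eqVlt; apply/orP; left; apply/eqP; ring.
Qed.

End Lattice.

(** * Superlevel sets *)

Section Counting.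
Context {R : realType} {N : nat}.
Local Notation V := 'rV[int]_N.
Implicit Types (u v : V -> R) (x y : V) (p s : R).

(** The points of the cube of side [M] with the origin as its lowest corner. *)
Definition box_pt {M} (h : {ffun 'I_N -> 'I_M}) : V := \row_i (h i : nat)%:Z.

Lemma box_pt_inj M : injective (@box_pt M).
Proof.
move=> h k /rowP hk; apply/ffunP => i; apply: val_inj.
by have := hk i; rewrite !mxE => -[].
Qed.

(** A point of the cube is a sum of at most [N * M] unit vectors. *)
Lemma psum_box_shift p u (X : R) M (h : {ffun 'I_N -> 'I_M}) : 1 <= p ->
  psum p (grad u) = X%:E ->
  (psum p (fun x => u (x + box_pt h)%R - u x)%R <= ((N * M)%:R `^ p * X)%:E)%E.
Proof.
move=> p1 uX; have X0 : 0 <= X by rewrite -lee_fin -uX psum_ge0.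
pose es : seq V := flatten [seq nseq (h i) (delta_mx 0 i) | i : 'I_N].
have -> : box_pt h = \sum_(e <- es) e.
  apply/rowP => j; rewrite big_flatten big_map big_enum /=.
  under eq_bigr do rewrite big_nseq iter_addr_0.
  rewrite summxE mxE (bigD1 j)//= big1 => [|i ij]; rewrite mulmxnE mxE eqxx /=.
    by rewrite addr0 eqxx mulr1n natz.
  by rewrite eq_sym (negbTE ij) mul0rn.
have unit_es : {in es, forall e : V, \sum_(i < N) `|e 0 i| = 1}.
  move=> e /flattenP[_ /mapP[i _ ->]] /nseqP[-> _].
  rewrite (bigD1 i)//= big1 ?addr0 => [|j ji]; rewrite mxE !eqxx//=.
  by rewrite (negbTE ji) normr0.
have size_es : (size es <= N * M)%N.
  rewrite size_flatten /shape -map_comp sumnE big_map big_enum /=.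
  rewrite -[X in (_ <= X * _)%N]card_ord -sum_nat_const; apply: leq_sum => i _.
  by rewrite size_nseq ltnW.
apply: (le_trans (psum_shift p1 uX unit_es)).
rewrite lee_fin ler_wpM2r// ge0_ler_powR ?nnegrE ?ler_nat//; lra.
Qed.

Lemma fsum_inj_le {H : finType} (A : pred H) (j : H -> V) s u : injective j ->
  (psum s u <= 1%:E)%E -> \sum_(h | A h) `|u (j h)| `^ s <= 1.
Proof.
move=> jI u1; have /psum_leP/(_ [fset h in enum A]%fset) :=
  le_trans (psum_inj s u jI) u1.
rewrite /fsum (perm_big (enum A)) ?big_enum//=.
apply: uniq_perm; rewrite ?fset_uniq ?enum_uniq// => h.
by rewrite !inE.
Qed.

(** By the lower bound on [M ^ N], more than half of a cube cannot carry values
    above [t / 2] when the power sum is at most 1.  So around each point of [F], half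
    of the cube contributes differences at least [t / 2].  Summing over [F] and over
    the cube in either order gives the estimate, from which [M ^ N] cancels. *)
Lemma card_superlevel p q u (X t : R) M (F : {fset V}) : 1 <= p -> 0 < q ->
  (psum q u <= 1%:E)%E -> psum p (grad u) = X%:E ->
  0 < t -> (0 < M)%N -> 2 <= (M ^ N)%:R * (t / 2) `^ q ->
  (forall x, x \in F -> t < `|u x|) ->
  #|` F|%:R * (t / 2) `^ p <= 2 * ((N * M)%:R `^ p * X).
Proof.
move=> p1 q0 u1 uX t0 M0 Mt tF.
pose H := {ffun 'I_N -> 'I_M} : finType.
have cardH : #|H| = (M ^ N)%N by rewrite card_ffun !card_ord.
have H0 : 0 < (M ^ N)%:R :> R by rewrite ltr0n expn_gt0 M0.
have t20 : 0 < t / 2 by rewrite divr_gt0.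
have tp0 : 0 < (t / 2) `^ p by rewrite powR_gt0.
have tq0 : 0 < (t / 2) `^ q by rewrite powR_gt0.
pose small x : pred H := fun h => `|u (x + box_pt h)| <= t / 2.
have many x : (M ^ N)%:R / 2 <= #|small x|%:R :> R.
  have jI : injective (fun h : H => x + box_pt h) by move=> h k /addrI/box_pt_inj.
  have few : #|predC (small x)|%:R * (t / 2) `^ q <= 1 :> R.
    apply: le_trans (fsum_inj_le (predC (small x)) jI u1).
    rewrite mulr_natl -sumr_const; apply: ler_sum => h /=; rewrite unfold_in /= -ltNge => /ltW th.
    by apply: ge0_ler_powR; rewrite ?nnegrE ?(ltW t20) ?(ltW q0).
  have : (M ^ N)%:R = #|small x|%:R + #|predC (small x)|%:R :> R by rewrite -natrD cardC cardH.
  have : 2 * #|predC (small x)|%:R <= (M ^ N)%:R :> R.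
    by rewrite -(ler_pM2r tq0) -mulrA (le_trans _ Mt)// -[leRHS]mulr1 ler_pM2l.
  lra.
have lower x : x \in F ->
    (M ^ N)%:R / 2 * (t / 2) `^ p <= \sum_(h : H) `|u (x + box_pt h) - u x| `^ p.
  move=> xF; apply: (@le_trans _ _ (#|small x|%:R * (t / 2) `^ p)).
    by rewrite ler_pM2r.
  rewrite mulr_natl -sumr_const [leRHS](bigID (small x))/= ler_wpDr ?sumr_ge0//.
  apply: ler_sum => h sh; apply: ge0_ler_powR; rewrite ?nnegrE ?(ltW t20)//; first lra.
  have := tF x xF; have := sh; rewrite unfold_in /small.
  have := lerB_dist (u x) (u (x + box_pt h)); rewrite distrC; lra.
have upper : \sum_(h : H) \sum_(x <- F) `|u (x + box_pt h) - u x| `^ p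
    <= (M ^ N)%:R * ((N * M)%:R `^ p * X).
  rewrite -cardH mulr_natl -sumr_const; apply: ler_sum => h _.
  by have /psum_leP := psum_box_shift h p1 uX; exact.
rewrite -(ler_pM2l H0).
have : #|` F|%:R * ((M ^ N)%:R / 2 * (t / 2) `^ p) <=
    \sum_(x <- F) \sum_(h : H) `|u (x + box_pt h) - u x| `^ p.
  rewrite cardfE mulr_natl -sumr_const big_seq_fsetE /=.
  by apply: ler_sum => x _; apply: lower; exact: valP.
rewrite exchange_big /= => /le_trans/(_ upper); lra.
Qed.

End Counting.

(** * Functions of bounded energy do not vanish *)

(** Layer-cake summation over the dyadic levels [d / 2^(k+1) < |u| <= d / 2^k].  The
    number of points at a level grows like [2^(k sg)] and the terms decay like
    [2^(- k q)], so the sum is geometric with ratio [2^(sg - q)]. *)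
Lemma fsum_of_superlevels {R : realType} {T : choiceType} (q sg : R) : 0 < sg < q ->
  exists2 C : R, 0 < C & forall (u : T -> R) (K d : R),
    0 <= K -> 0 < d <= 1 -> (forall x, `|u x| <= d) ->
    (forall t (F : {fset T}), 0 < t <= 1 -> (forall x, x \in F -> t < `|u x|) ->
       #|` F|%:R <= K * t `^ (- sg)) ->
    forall F, fsum F q u <= C * K * d `^ (q - sg).
Proof.
move=> /andP[sg0 sgq]; have q0 : 0 < q by exact: lt_trans sgq.
pose g : R := 2^-1 `^ (q - sg).
have g0 : 0 < g by rewrite powR_gt0.
have g1 : g < 1.
  have <- : 1 `^ (q - sg) = 1 :> R by rewrite powR1.
  by rewrite gt0_ltr_powR ?subr_gt0 ?nnegrE ?invr_ge0// invf_lt1// ltr1n.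
have g'0 : 0 < 1 - g by rewrite subr_gt0.
(* This constant solves [C = 2^sg + g * C], which is what the induction step needs. *)
exists (2 `^ sg / (1 - g)); first by rewrite divr_gt0// powR_gt0.
move=> u K d K0 d01 ud cardK F.
set C := 2 `^ sg / (1 - g).
have C0 : 0 < C by rewrite divr_gt0// powR_gt0.
have layers k : forall e (G : {fset T}), 0 < e <= 1 ->
    (forall x, x \in G -> e / 2 ^+ k < `|u x| <= e) ->
    fsum G q u <= C * K * e `^ (q - sg).
  elim: k => [e G e01 Ge|k IH e G /andP[e0 e1] Ge].
    rewrite /fsum big_seq big1 => [|x /Ge]; last first.
      by rewrite expr0 divr1 => /andP[/lt_le_trans h /h]; rewrite ltxx.
    by rewrite mulr_ge0 ?powR_ge0// mulr_ge0// ltW.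
  rewrite /fsum (big_fsetID _ [pred x | e / 2 < `|u x|] G)/=.
  have e20 : 0 < e / 2 by rewrite divr_gt0.
  have -> : C * K * e `^ (q - sg) =
      K * 2 `^ sg * e `^ (q - sg) + C * K * (e / 2) `^ (q - sg).
    rewrite (powRM (q - sg) (ltW e0)) ?invr_ge0// -/g /C; field.
    by rewrite gt_eqF.
  apply: lerD; last first.
    apply: IH => [|x]; first by rewrite e20 /=; lra.
    rewrite !inE /= -leNgt => /andP[/Ge /andP[h _] ->]; rewrite andbT.
    by move: h; rewrite exprS invfM mulrA.
  have h : (#|` [fset x in G | (e / 2 < `|u x|)%R]%fset|%:R : R) <= K * (e / 2) `^ (- sg).
    by apply: cardK => [|x]; [rewrite e20 /=; lra | rewrite !inE /= => /andP[]].
  apply: (@le_trans _ _ (#|` [fset x in G | (e / 2 < `|u x|)%R]%fset|%:R * e `^ q)).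
    rewrite cardfE mulr_natl -sumr_const big_seq_fsetE /=; apply: ler_sum => x _.
    apply: ge0_ler_powR; rewrite ?nnegrE ?(ltW q0) ?(ltW e0)//.
    by have := valP x; rewrite !inE /= => /andP[/Ge /andP[]].
  apply: (@le_trans _ _ (K * (e / 2) `^ (- sg) * e `^ q)); first by rewrite ler_wpM2r// powR_ge0.
  rewrite powRM ?invr_ge0 ?(ltW e0)//.
  have -> : 2^-1 `^ (- sg) = 2 `^ sg :> R by rewrite -powR_inv1// -powRrM mulrNN mul1r.
  rewrite powRB ?powRN; last by rewrite (gt_eqF e0) implybT.
  by rewrite le_eqVlt; apply/orP; left; apply/eqP; ring.
(* The zeros of [u] contribute nothing; on the rest of [F], [|u|] is bounded below
   by some [m > 0], so that finitely many levels suffice. *)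
rewrite /fsum (bigID (fun x => u x == 0))/= big1 ?add0r => [|x /eqP ->]; last first.
  by rewrite normr0 powR0 ?gt_eqF.
have seq_lb (G : seq T) : exists2 m : R, 0 < m & forall x, x \in G -> u x != 0 -> m < `|u x|.
  elim: G => [|x G [m m0 mG]]; first by exists 1.
  exists (if u x == 0 then m else Num.min m (`|u x| / 2)).
    by case: eqP => // /eqP ux; rewrite lt_min m0 divr_gt0// normr_gt0.
  move=> y; rewrite !inE => /orP[/eqP ->|yG] uy.
    by rewrite (negbTE uy) gt_min; apply/orP; right; rewrite ltr_pdivrMr// ltr_pMr ?normr_gt0// ltr1n.
  by case: eqP => _; rewrite ?gt_min mG.
have [m m0 mF] := seq_lb (enum_fset F).
have /andP[d0 d1] := d01.
have [k kd] : exists k : nat, d / 2 ^+ k <= m.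
  exists (Num.truncn (d / m)).+1; rewrite ler_pdivrMr ?exprn_gt0// mulrC -ler_pdivrMr//.
  apply/ltW/(lt_le_trans (truncnS_gt _)).
  by rewrite -natrX ler_nat ltnW// ltn_expl.
have -> : \sum_(x <- F | u x != 0) `|u x| `^ q = fsum [fset x in F | u x != 0]%fset q u.
  by rewrite /fsum big_fset_condE.
apply: (layers k) => // x; rewrite !inE /= => /andP[xF ux].
by rewrite ud andbT; apply: le_lt_trans kd _; exact: mF.
Qed.

Section NonVanishing.
Context {R : realType} {N : nat}.
Local Notation V := 'rV[int]_N.
Implicit Types (u v : V -> R) (x y : V) (p q r : R).

(** [card_superlevel] for an integer [M] comparable with the least admissible side
    [y = (2 (2/t)^q)^(1/N)]. *)
Lemma superlevel_gradient_bound p q : (0 < N)%N -> 1 <= p -> 0 < q ->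
  exists2 C : R, 0 < C & forall u X t (F : {fset V}),
    (psum q u <= 1%:E)%E -> psum p (grad u) = X%:E -> 0 < t <= 1 ->
    (forall x, x \in F -> t < `|u x|) ->
    #|` F|%:R <= C * X * t `^ (- (p * (1 + q / N%:R))).
Proof.
move=> N0 p1 q0; have p0 : 0 < p by lra.
have NR : 0 < N%:R :> R by rewrite ltr0n.
pose e := p * (1 + q / N%:R).
exists (2 * (2 * N%:R) `^ p * 2 `^ (p / N%:R) * 2 `^ e).
  by rewrite !mulr_gt0 ?powR_gt0// mulr_gt0.
move=> u X t F u1 uX /andP[t0 t1] tF.
have X0 : 0 <= X by rewrite -lee_fin -uX psum_ge0.
have t2 : 0 < 2 / t by rewrite divr_gt0.
have z0 : 0 < 2 * (2 / t) `^ q by rewrite mulr_gt0// powR_gt0.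
pose y := (2 * (2 / t) `^ q) `^ (N%:R^-1).
have y1 : 1 <= y.
  apply: powR_ge1; rewrite ?invr_ge0 ?(ltW NR)//.
  have : 1 <= (2 / t) `^ q.
    by apply: powR_ge1; rewrite ?(ltW q0)// ler_pdivlMr//; lra.
  lra.
have y0 : 0 < y by lra.
have [M yM My] : exists2 M : nat, y < M%:R & M%:R <= 2 * y.
  exists (Num.truncn y).+1; first exact: truncnS_gt.
  rewrite -natr1; have : (Num.truncn y)%:R <= y by rewrite truncn_le ltW.
  lra.
have M0 : (0 < M)%N by rewrite -(ltr0n R); exact: lt_trans yM.
have yN : y ^+ N = 2 * (2 / t) `^ q.
  by rewrite -powR_mulrn ?(ltW y0)// -powRrM mulVf ?gt_eqF// powRr1// ltW.
have inv : (2 / t) `^ q * (t / 2) `^ q = 1.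
  rewrite -powRM ?(ltW t2) ?divr_ge0 ?(ltW t0)//.
  by rewrite (_ : 2 / t * (t / 2) = 1) ?powR1//; field; rewrite gt_eqF.
have Mt : 2 <= (M ^ N)%:R * (t / 2) `^ q.
  apply: (@le_trans _ _ (y ^+ N * (t / 2) `^ q)); first by rewrite yN -mulrA inv mulr1.
  by rewrite ler_wpM2r ?powR_ge0// natrX lerXn2r ?nnegrE ?(ltW y0) ?(ltW yM).
have := card_superlevel p1 q0 u1 uX t0 M0 Mt tF.
have tp0 : 0 < (t / 2) `^ p by rewrite powR_gt0// divr_gt0.
rewrite -ler_pdivlMr// => /le_trans; apply.
have -> : ((t / 2) `^ p)^-1 = (2 / t) `^ p.
  by rewrite -powR_inv1 ?powR_ge0// powRAC powR_inv1 ?divr_ge0 ?(ltW t0)// invf_div.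
have NM : (N * M)%:R `^ p <= (2 * N%:R) `^ p * y `^ p :> R.
  have N2 : 0 <= 2 * N%:R :> R by rewrite mulr_ge0 ?ler0n.
  rewrite -(@powRM _ (2 * N%:R) y p N2 (ltW y0)).
  apply: ge0_ler_powR; rewrite ?nnegrE ?ler0n ?(ltW p0)//; first exact: mulr_ge0 N2 (ltW y0).
  by rewrite natrM -mulrA [2 * _]mulrCA ler_pM2l// mulrC [leRHS]mulrC.
apply: (@le_trans _ _ (2 * ((2 * N%:R) `^ p * y `^ p * X) * (2 / t) `^ p)).
  by rewrite ler_wpM2r ?powR_ge0// ler_wpM2l// ler_wpM2r.
have -> : y `^ p = 2 `^ (p / N%:R) * (2 / t) `^ (q * (p / N%:R)).
  rewrite /y -powRrM [_^-1 * _]mulrC powRM ?powR_ge0//.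
  by rewrite -[((2 / t) `^ q) `^ _]powRrM.
rewrite -/e le_eqVlt; apply/orP; left; apply/eqP.
have -> : t `^ (- e) = (t^-1) `^ e.
  by rewrite -powR_inv1 ?(ltW t0)// -powRrM mulN1r.
have E : (2 / t) `^ (q * (p / N%:R)) * (2 / t) `^ p = 2 `^ e * t^-1 `^ e.
  rewrite -powRD; last by rewrite (gt_eqF t2) implybT.
  rewrite -powRM ?invr_ge0 ?(ltW t0)//; congr (_ `^ _).
  by rewrite /e; field; rewrite gt_eqF.
rewrite [LHS](_ : _ = 2 * (2 * N%:R) `^ p * 2 `^ (p / N%:R) * X *
  ((2 / t) `^ (q * (p / N%:R)) * (2 / t) `^ p)); last by ring.
by rewrite E; ring.
Qed.

(** Chebyshev's inequality. *)
Lemma superlevel_norm_bound r u Y t (F : {fset V}) : 0 <= r -> psum r u = Y%:E ->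
  0 < t -> (forall x, x \in F -> t < `|u x|) -> #|` F|%:R <= Y * t `^ (- r).
Proof.
move=> r0 uY t0 tF; rewrite powRN ler_pdivlMr ?powR_gt0//.
apply: le_trans (fsum_le F uY).
rewrite cardfE mulr_natl -sumr_const /fsum big_seq_fsetE /=; apply: ler_sum => x _.
by apply: ge0_ler_powR; rewrite ?nnegrE ?(ltW t0)// ltW// tF// valP.
Qed.

(** The two bounds on the superlevel sets, raised to the powers [al = theta / p] and
    [be = (1 - theta) / r] and multiplied, bound the [al + be]-th power of their cardinal
    by the energy times [t^(-(1 + theta q / N))].  The hypothesis on [q^-1] is equivalent to
    [sg = (1 + theta q / N) / (al + be) < q], the condition of [fsum_of_superlevels]. *)
Lemma nonvanishing p q r theta E : (0 < N)%N -> 1 < p -> 0 < r -> 0 < q ->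
  0 <= theta <= 1 -> q^-1 < theta * (p^-1 - N%:R^-1) + (1 - theta) / r -> 0 < E ->
  exists2 d : R, 0 < d & forall u X Y, psum q u = 1%:E ->
    psum p (grad u) = X%:E -> psum r u = Y%:E ->
    X `^ (theta / p) * Y `^ ((1 - theta) / r) <= E -> exists x, d < `|u x|.
Proof.
move=> N0 p1 r0 q0 /andP[th0 th1] hq E0; have p0 : 0 < p by lra.
have NR : 0 < N%:R :> R by rewrite ltr0n.
have qN : 0 <= q / N%:R by rewrite divr_ge0 ?ltW.
set al := theta / p; set be := (1 - theta) / r; set m := al + be.
have al0 : 0 <= al by rewrite divr_ge0 ?(ltW p0).
have be0 : 0 <= be by rewrite divr_ge0 ?subr_ge0 ?(ltW r0).
have hm : q^-1 + theta / N%:R < m.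
  by move: hq; rewrite mulrBr -/al -/be /m; set z := theta * N%:R^-1; rewrite -/z; lra.
have m0 : 0 < m.
  by apply: lt_trans hm; rewrite ltr_pwDl ?invr_gt0// divr_ge0// ltW.
have [C C0 grad_bound] := superlevel_gradient_bound N0 (ltW p1) q0.
pose sg := (1 + theta * (q / N%:R)) / m.
have sg01 : 0 < sg < q.
  apply/andP; split; first by rewrite divr_gt0// ltr_pwDl// mulr_ge0.
  rewrite ltr_pdivrMr//.
  rewrite -(ltr_pM2l q0) in hm; apply: le_lt_trans hm.
  by rewrite mulrDr divff ?gt_eqF// lerD2l mulrCA.
pose K := (C `^ al * E) `^ m^-1.
have K0 : 0 <= K by exact: powR_ge0.
have [C' C'0 layers] := fsum_of_superlevels (T := V) sg01.
have qsg : 0 < q - sg by rewrite subr_gt0; case/andP: sg01.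
have CK : 0 < C' * K + 1 by rewrite ltr_wpDl// mulr_ge0// ltW.
(* Chosen so that [C' * K * d0 `^ (q - sg) < 1]. *)
pose d0 := (C' * K + 1)^-1 `^ (q - sg)^-1.
have d00 : 0 < d0 by rewrite powR_gt0// invr_gt0.
have d01 : d0 <= 1.
  apply: powR_le1; rewrite ?invr_gt0 ?invr_ge0 ?(ltW qsg) ?CK//=.
  by rewrite invf_le1// lerDr mulr_ge0// ltW.
exists d0 => // u X Y u1 uX uY XYE; apply/not_existsP => small.
have : (psum q u <= (C' * K * d0 `^ (q - sg))%:E)%E.
  apply/psum_leP; apply: layers => //; first by rewrite d00.
    by move=> x; rewrite leNgt; apply/negP; exact: small.
  move=> t F /andP[t0 t1] tF; have [->|Fn0] := eqVneq (#|` F|%:R : R) 0.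
    by rewrite mulr_ge0 ?powR_ge0.
  set n := #|` F|%:R in Fn0 *; have n0 : 0 < n by rewrite lt_neqAle eq_sym Fn0 ler0n.
  have X0 : 0 <= X by rewrite -lee_fin -uX psum_ge0.
  have Y0 : 0 <= Y by rewrite -lee_fin -uY psum_ge0.
  have t01 : 0 < t <= 1 by rewrite t0.
  have nX := grad_bound u X t F _ uX t01 tF; rewrite u1 lexx in nX; have {}nX := nX isT.
  have nY := superlevel_norm_bound (ltW r0) uY t0 tF.
  rewrite -/n in nX nY.
  have nm : n `^ m <= C `^ al * E * t `^ (- (sg * m)).
    rewrite /m powRD; last by rewrite (gt_eqF n0) implybT.
    apply: (@le_trans _ _ ((C * X * t `^ (- (p * (1 + q / N%:R)))) `^ al * (Y * t `^ (- r)) `^ be)).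
      have CX0 : 0 <= C * X * t `^ (- (p * (1 + q / N%:R))).
        exact: mulr_ge0 (mulr_ge0 (ltW C0) X0) (powR_ge0 _ _).
      have Yt0 : 0 <= Y * t `^ (- r) by exact: mulr_ge0 Y0 (powR_ge0 _ _).
      apply: ler_pM; rewrite ?powR_ge0//; apply: ge0_ler_powR => //;
        by rewrite nnegrE ltW.
    rewrite !powRM ?mulr_ge0 ?powR_ge0 ?(ltW C0)// -!powRrM.
    have -> : C `^ al * X `^ al * t `^ (- (p * (1 + q / N%:R)) * al) *
        (Y `^ be * t `^ (- r * be)) = C `^ al * (X `^ al * Y `^ be) *
        (t `^ (- (p * (1 + q / N%:R)) * al) * t `^ (- r * be)) by ring.
    rewrite -powRD; last by rewrite (gt_eqF t0) implybT.
    have -> : - (p * (1 + q / N%:R)) * al + - r * be = - (sg * m).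
      rewrite /sg divfK ?gt_eqF// /al /be; field.
      by rewrite !gt_eqF.
    by rewrite ler_wpM2r ?powR_ge0// ler_wpM2l ?powR_ge0.
  have -> : n = (n `^ m) `^ m^-1 by rewrite -powRrM divff ?gt_eqF// powRr1// ltW.
  have -> : K * t `^ (- sg) = (C `^ al * E * t `^ (- (sg * m))) `^ m^-1.
    rewrite powRM ?mulr_ge0 ?powR_ge0 ?(ltW E0)// -/K -powRrM.
    by rewrite mulNr mulfK ?gt_eqF.
  by apply: ge0_ler_powR; rewrite ?nnegrE ?invr_ge0 ?(ltW m0) ?powR_ge0
    ?mulr_ge0 ?powR_ge0 ?(ltW E0).
rewrite u1 lee_fin /d0 -powRrM mulVf ?gt_eqF// powRr1 ?invr_ge0 ?(ltW CK)//.
by rewrite ler_pdivlMr// mul1r; lra.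
Qed.

(** A function with [lnorm q] at most 1 that is not small at one point has to decrease
    somewhere; quantitatively, [superlevel_gradient_bound] for a one-point set. *)
Lemma gradient_lower_bound p q t : (0 < N)%N -> 1 <= p -> 0 < q -> 0 < t ->
  exists2 m : R, 0 < m & forall u X x, (psum q u <= 1%:E)%E ->
    psum p (grad u) = X%:E -> t < `|u x| -> m <= X.
Proof.
move=> N0 p1 q0 t0; have [C C0 bound] := superlevel_gradient_bound N0 p1 q0.
set e := - (p * (1 + q / N%:R)) in bound.
pose s := Num.min t 1.
have s0 : 0 < s by rewrite lt_min t0 /=.
have s1 : s <= 1 by rewrite ge_min lexx orbT.
(* The bound for the one-point set reads [1 <= C * X * s `^ e]. *)
exists (C * s `^ e)^-1; first by rewrite invr_gt0 mulr_gt0// powR_gt0.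
move=> u X x u1 uX tx.
have s01 : 0 < s <= 1 by rewrite s0.
have sx y : y \in [fset x]%fset -> s < `|u y|.
  by rewrite inE => /eqP ->; rewrite gt_min tx.
have := bound u X s [fset x]%fset u1 uX s01 sx.
rewrite cardfs1 mulrAC => h; rewrite -div1r ler_pdivrMr ?mulr_gt0 ?powR_gt0// mulrC.
exact: h.
Qed.

End NonVanishing.

(** * The space D0 and the energy *)

Section Energy.
Context {R : realType} {N : nat}.
Local Notation V := 'rV[int]_N.
Implicit Types (u v : V -> R) (x y : V) (p q r : R).

(** The projection of the line onto the interval [-e, e]; subtracting it is soft thresholding. *)
Definition clip (e a : R) : R := Num.max (- e) (Num.min a e).

Lemma clip_lip e a b : `|clip e a - clip e b| <= `|a - b|.
Proof.
have h1 := ler_norm (a - b); have h2 := ler_norm (b - a).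
rewrite distrC in h2; rewrite ler_norml /clip !minEle.
by do ![case: ifPn; rewrite -?ltNge => ?]; rewrite !maxEle;
  do ![case: ifPn; rewrite -?ltNge => ?]; lra.
Qed.

Lemma clip_bound e a : 0 <= e -> `|clip e a| <= e.
Proof.
move=> e0; rewrite ler_norml /clip !minEle.
by do ![case: ifPn; rewrite -?ltNge => ?]; rewrite !maxEle;
  do ![case: ifPn; rewrite -?ltNge => ?]; lra.
Qed.

Lemma clip_id e a : `|a| <= e -> clip e a = a.
Proof.
rewrite ler_norml /clip minEle => /andP[? ?].
by case: ifPn; rewrite -?ltNge maxEle => ?; case: ifPn; rewrite -?ltNge => ?; lra.
Qed.

Lemma finite_superlevel q u (a e : R) : 0 < q -> psum q u = a%:E -> 0 < e ->
  finite_set [set x | e < `|u x|].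
Proof.
move=> q0 ua e0; apply: contrapT => inf.
have [F FA cF] := infinite_set_fset (Num.truncn (a * e `^ (- q))).+1 inf.
have := superlevel_norm_bound (ltW q0) ua e0 (fun x => FA x).
apply/negP; rewrite -ltNge (lt_le_trans (truncnS_gt _))// ler_nat.
exact: cF.
Qed.

Lemma grad_abs_le u x y : `|grad u (x, y)| <= `|u y - u x|.
Proof. by rewrite /grad; case: ifP => // _; rewrite normr0. Qed.

(** The soft thresholds [u - clip (1/(n+1)) u] have finite support, since [u] has finite
    superlevel sets, and they converge uniformly.  As [clip] is 1-Lipschitz, the gradient
    of [clip (1/(n+1)) u] is dominated by that of [u], so its power sum tends to 0. *)
Lemma D0_of_finite p q u (a X : R) : 0 < p -> 0 < q -> psum q u = a%:E ->
  psum p (grad u) = X%:E -> D0 p u.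
Proof.
move=> p0 q0 ua uX; pose e n : R := n.+1%:R^-1.
have e0 n : 0 < e n by rewrite invr_gt0.
have ecvg : e n @[n --> \oo] --> (0 : R) by exact: cvg_harmonic.
exists (fun n x => u x - clip (e n) (u x)); split.
- move=> n; apply: sub_finite_set (finite_superlevel q0 ua (e0 n)) => x /=.
  by apply: contra_neqT; rewrite -leNgt => /clip_id ->; rewrite subrr.
- have clip0 x : clip (e n) (u x) @[n --> \oo] --> (0 : R).
    apply/norm_cvg0P; apply: (@squeeze_cvgr _ _ _ _ (fun=> 0) e) ecvg => //.
      by apply: nearW => n; rewrite normr_ge0 clip_bound// ltW.
    exact: cvg_cst.
  by move=> x; rewrite -[X in _ --> X]subr0; apply: cvgB (clip0 x); exact: cvg_cst.
pose w n x := clip (e n) (u x).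
have gw n k : `|grad (w n) k| <= `|grad u k|.
  by case: k => x y; rewrite /grad; case: ifP => // _; exact: clip_lip.
have fin n : exists A : R, psum p (grad (w n)) = A%:E.
  have h k : `|grad (w n) k| `^ p <= 1 * `|grad u k| `^ p + 0 * `|grad u k| `^ p.
    by rewrite mul1r mul0r addr0; apply: ge0_ler_powR; rewrite ?nnegrE ?(ltW p0).
  by have [A ? _] := psum_fin (psum_le_lin uX uX ler01 (lexx 0) h); exists A.
have [A wA] := choice fin.
have A0 : A n @[n --> \oo] --> (0 : R).
  apply: (psum_dominated_cvg0 p0 uX gw _ wA) => -[x y].
  apply/norm_cvg0P; apply: (@squeeze_cvgr _ _ _ _ (fun=> 0) (fun n => e n + e n)).
  - apply: nearW => n; rewrite normr_ge0 (le_trans (grad_abs_le _ _ _))//.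
    by rewrite (le_trans (ler_normB _ _))// lerD// clip_bound// ltW.
  - exact: cvg_cst.
  - by rewrite -[X in _ --> X](addr0 0); exact: cvgD.
rewrite [X in X @ _ --> _](_ : _ = fun n => (A n `^ p^-1)%:E); last first.
  apply/funext => n; rewrite DnormE// -poweR_EFin -wA -psumN; congr (psum _ _ `^ _)%E.
  by apply/funext => -[x y]; rewrite /grad /w /=; case: ifP => _; [ring | rewrite oppr0].
apply: cvg_EFin; first by apply: nearW.
have <- : 0 `^ p^-1 = 0 :> R by rewrite powR0 ?gt_eqF ?invr_gt0.
apply: cvg_powR => //; first by rewrite invr_ge0 ltW.
by move=> n; rewrite -lee_fin -wA psum_ge0.
Qed.

Lemma lnorm1 q u : 0 < q -> lnorm q u = 1%E -> psum q u = 1%:E.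
Proof.
move=> q0; rewrite /lnorm -/(psum q u); have := psum_ge0 q u.
case: (psum q u) => [a a0 |_ |//]; last by rewrite poweRyr ?gt_eqF ?invr_gt0.
rewrite poweR_EFin => -[/eqP]; rewrite powR_eq1 => /or3P[/eqP -> //||].
  by rewrite lee_fin in a0; rewrite ltNge a0.
by rewrite gt_eqF// invr_gt0.
Qed.

Lemma energyE p r theta u (X Y : R) : 0 < p -> psum p (grad u) = X%:E ->
  psum r u = Y%:E ->
  energy p r theta u = (X `^ (theta / p) * Y `^ ((1 - theta) / r))%:E.
Proof.
move=> p0 uX uY; rewrite /energy DnormE// uX /lnorm -/(psum r u) uY.
by rewrite !poweR_EFin -EFinM -!powRrM ![_^-1 * _]mulrC.
Qed.

Lemma gradZ (c : R) u : grad (fun x => c * u x) = (fun k => c * grad u k).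
Proof. by apply/funext => -[x y]; rewrite /grad /=; case: ifP => _; rewrite ?mulr0 ?mulrBr. Qed.

Lemma gradB u v : grad (u \- v) = grad u \- grad v.
Proof. by apply/funext => -[x y]; rewrite /grad /=; case: ifP => _; [ring | rewrite subr0]. Qed.

(** The definition of the infimum for [u / lnorm q u], in terms of power sums.  This form
    is homogeneous and passes to the limit along the remainders [w n - u]. *)
Lemma Kinf_scaling p r theta q (k : R) u (B X Y : R) :
  0 < p -> 0 < q -> 0 < r ->
  Kinf N p r theta q = k%:E ->
  psum q u = B%:E -> psum p (grad u) = X%:E -> psum r u = Y%:E ->
  k * B `^ q^-1 <= X `^ (theta / p) * Y `^ ((1 - theta) / r).
Proof.
move=> p0 q0 r0 Kk uB uX uY.
have X0 : 0 <= X by rewrite -lee_fin -uX psum_ge0.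
have Y0 : 0 <= Y by rewrite -lee_fin -uY psum_ge0.
have : 0 <= B by rewrite -lee_fin -uB psum_ge0.
rewrite le_eqVlt => /predU1P[<-|B0].
  by rewrite powR0 ?gt_eqF ?invr_gt0// mulr0 mulr_ge0 ?powR_ge0.
have [c cE] : exists c, B `^ q^-1 = c by exists (B `^ q^-1).
have c0 : 0 < c by rewrite -cE powR_gt0.
have ic0 : c^-1 != 0 by rewrite invr_eq0 gt_eqF.
have cq (s : R) Z : 0 <= Z -> (`|c^-1| `^ s * Z) = c `^ (- s) * Z.
  by move=> Z0; rewrite ger0_norm ?invr_ge0 ?(ltW c0)// -powR_inv1 ?(ltW c0)// -powRrM mulN1r.
have vB := psumZ ic0 uB.
have vX : psum p (grad (fun x => c^-1 * u x)) = (`|c^-1| `^ p * X)%:E.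
  by rewrite gradZ; exact: (psumZ ic0 uX).
have vY := psumZ ic0 uY.
rewrite !cq ?(ltW B0) ?X0 ?Y0// in vB vX vY.
have {}vB : psum q (fun x => c^-1 * u x) = 1%:E.
  rewrite vB; congr (_%:E); rewrite -cE -powRrM mulrN mulVf ?gt_eqF//.
  by rewrite powR_inv1 ?(ltW B0)// mulVf ?gt_eqF.
have : (Kinf N p r theta q <= energy p r theta (fun x => c^-1 * u x)%R)%E.
  apply: ereal_inf_lbound; exists (fun x => c^-1 * u x) => //; split.
    exact: (D0_of_finite p0 q0 vB vX).
  by rewrite /lnorm -/(psum q _) vB poweR1r.
rewrite cE Kk (energyE _ p0 vX vY) lee_fin -ler_pdivlMr//.
move=> /le_trans; apply; rewrite !powRM ?powR_ge0// -!powRrM.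
rewrite mulrACA -powRD; last by rewrite (gt_eqF c0) implybT.
rewrite (_ : - p * (theta / p) + - r * ((1 - theta) / r) = -1); last first.
  by field; rewrite !gt_eqF.
by rewrite powR_inv1 ?(ltW c0)// mulrC.
Qed.

(** Neither norm vanishes, so an infinite factor would make the energy infinite.  When
    the exponent of [lnorm r] is 0, [r = q] and the norm is 1. *)
Lemma finite_energy p q r theta u : (0 < N)%N -> 1 < p -> 0 < q -> 0 < r ->
  0 < theta -> theta <= 1 -> (theta < 1 \/ r = q) -> psum q u = 1%:E ->
  (energy p r theta u < +oo)%E ->
  exists X Y : R, psum p (grad u) = X%:E /\ psum r u = Y%:E.
Proof.
move=> N0 p1 q0 r0 th0 th1 thr u1.
have p0 : 0 < p by lra.
have [x ux] : exists x, u x != 0.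
  apply: (@psum_neq0_ex _ _ q); first by rewrite gt_eqF.
  by rewrite u1; apply/eqP => -[] /eqP; rewrite oner_eq0.
have Y0 := psum_gt0 r ux.
have X0 : (0 < psum p (grad u))%E.
  rewrite lt_neqAle psum_ge0 andbT; apply/eqP => /esym X0.
  have ux2 : 0 < `|u x| / 2 by rewrite divr_gt0 ?normr_gt0.
  have [m m0] := gradient_lower_bound N0 (ltW p1) q0 ux2.
  move=> /(_ u 0 x); rewrite u1 => /(_ (lexx _) X0); rewrite leNgt m0.
  rewrite ltr_pdivrMr// ltr_pMr ?normr_gt0// ltr1n => /(_ isT).
  by [].
rewrite /energy DnormE// /lnorm -/(psum r u).
case EX: (psum p (grad u)) X0 => [X||]// X0; last first.
  rewrite !poweRyr ?gt_eqF ?invr_gt0//.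
  by rewrite gt0_mulye ?ltxx// !poweR_gt0.
case EY: (psum r u) Y0 => [Y||]// Y0; first by exists X, Y.
case: thr => [th|rq]; last by move: EY; rewrite rq u1.
rewrite !poweRyr ?gt_eqF ?invr_gt0 ?subr_gt0//.
by rewrite gt0_muley ?ltxx// !poweR_gt0.
Qed.

End Energy.

(** * The indicator of the origin *)

Section PointMass.
Context {R : realType} {N : nat}.
Local Notation V := 'rV[int]_N.
Implicit Types p q : R.

Definition delta0 : V -> R := fun x => (x == 0)%:R.

Lemma psum_delta0 (s : R) : s != 0 -> psum s delta0 = 1%:E.
Proof.
move=> s0; rewrite -(esum_set1 (T := V) (t := 0) (a := fun=> 1%E)) ?lee01//.
rewrite [RHS]esum_mkcond; apply: eq_esum => x _; rewrite /delta0.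
have [->|x0] := eqVneq x 0; first by rewrite mem_set// normr1 powR1.
by rewrite memNset ?normr0 ?powR0//; apply/eqP.
Qed.

Lemma D0_delta0 p : 0 < p -> D0 p delta0.
Proof.
move=> p0; exists (fun=> delta0); split.
- move=> _; apply: (sub_finite_set _ (finite_set1 (0 : V))) => x /=.
  by rewrite /delta0; have [->|x0 /negP[]] := eqVneq x 0.
- by move=> x; exact: cvg_cst.
- rewrite DnormE// (_ : psum _ _ = 0%E) ?poweR0r ?gt_eqF ?invr_gt0//.
    exact: cvg_cst.
  apply: esum1 => -[x y] _; rewrite /grad /= !subrr if_same normr0.
  by rewrite powR0 ?gt_eqF.
Qed.

Lemma admissible_delta0 p q : 0 < p -> 0 < q -> admissible p q delta0.
Proof.
move=> p0 q0; split; first exact: D0_delta0.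
by rewrite /lnorm -/(psum q delta0) psum_delta0 ?poweR1r// gt_eqF.
Qed.

End PointMass.

(** * Existence of a minimizer *)

Section Main.
Context {R : realType} {N : nat}.
Local Notation V := 'rV[int]_N.

(** The second alternative [r = q] covers [theta = 1], where the energy gives no control of
    [lnorm r]. *)
Lemma minimizer_interior (p q r theta k : R) : (0 < N)%N ->
  1 < p -> 1 < q -> 1 < r -> 0 < theta -> theta <= 1 -> (theta < 1 \/ r = q) ->
  q^-1 < theta * (p^-1 - N%:R^-1) + (1 - theta) / r ->
  Kinf N p r theta q = k%:E ->
  exists u : V -> R, [/\ D0 p u, lnorm q u = 1%E & energy p r theta u = k%:E].
Proof.
move=> N0 p1 q1 r1 th0 th1 thr hq Kk.
have p0 : 0 < p by lra. have q0 : 0 < q by lra. have r0 : 0 < r by lra.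
have [al alE] : exists al, theta / p = al by exists (theta / p).
have [be beE] : exists be, (1 - theta) / r = be by exists ((1 - theta) / r).
have al0 : 0 < al by rewrite -alE divr_gt0.
have be0 : 0 <= be by rewrite -beE divr_ge0 ?subr_ge0 ?(ltW r0).
have hm : q^-1 < al + be.
  apply: lt_le_trans hq _; rewrite mulrBr alE beE lerD2r gerBl.
  by rewrite mulr_ge0 ?invr_ge0 ?ler0n// ltW.
have energy_ge (u : V -> R) B X Y : psum q u = B%:E -> psum p (grad u) = X%:E -> psum r u = Y%:E ->
    k * B `^ q^-1 <= X `^ al * Y `^ be.
  by move=> uB uX uY; rewrite -alE -beE; exact: (Kinf_scaling p0 q0 r0 Kk uB uX uY).
have k0 : 0 <= k.
  rewrite -lee_fin -Kk; apply: le_ereal_inf_tmp => _ [u _ <-].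
  by rewrite mule_ge0// poweR_ge0.
have [d d0 nonvan] : exists2 d : R, 0 < d & forall (u : V -> R) X Y, psum q u = 1%:E ->
    psum p (grad u) = X%:E -> psum r u = Y%:E ->
    X `^ al * Y `^ be <= k + 1 -> exists x, d < `|u x|.
  rewrite -alE -beE; apply: (nonvanishing N0 p1 r0 q0) => //; first by rewrite ltW.
  by rewrite ltr_wpDl.
(* A minimizing sequence, translated so that it stays above [d] at the origin. *)
have seq n : exists wXY : (V -> R) * (R * R),
    [/\ psum q wXY.1 = 1%:E, psum p (grad wXY.1) = wXY.2.1%:E,
        psum r wXY.1 = wXY.2.2%:E,
        wXY.2.1 `^ al * wXY.2.2 `^ be <= k + n.+1%:R^-1 & d < `|wXY.1 0|].
  have n0 : 0 < n.+1%:R^-1 :> R by rewrite invr_gt0.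
  have Kfin : Kinf N p r theta q \is a fin_num by rewrite Kk.
  have [_ [u [D0u qu] <-]] := lb_ereal_inf_adherent n0 Kfin.
  rewrite -/(Kinf N p r theta q) Kk => lt_k.
  have u1 := lnorm1 q0 qu.
  have lt_oo : (energy p r theta u < +oo)%E by apply: lt_trans lt_k _; rewrite ltry.
  have [X [Y [uX uY]]] := finite_energy N0 p1 q0 r0 th0 th1 thr u1 lt_oo.
  rewrite (energyE theta p0 uX uY) alE beE -EFinD lte_fin in lt_k.
  have [x dx] : exists x, d < `|u x|.
    apply: (nonvan u X Y) => //; apply: le_trans (ltW lt_k) _.
    by rewrite lerD2l invf_le1 ?ler1n.
  exists (fun y => u (y + x), (X, Y)); split => /=.
  - by rewrite psum_translate.
  - by rewrite psum_grad_translate.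
  - by rewrite psum_translate.
  - exact: ltW.
  - by rewrite add0r.
have [w_ wP] := choice seq.
pose w n := (w_ n).1; pose X n := (w_ n).2.1; pose Y n := (w_ n).2.2.
have wq n : psum q (w n) = 1%:E by case: (wP n).
have wX n : psum p (grad (w n)) = (X n)%:E by case: (wP n).
have wY n : psum r (w n) = (Y n)%:E by case: (wP n).
have wE n : X n `^ al * Y n `^ be <= k + n.+1%:R^-1 by case: (wP n).
have wd n : d < `|w n 0| by case: (wP n).
clearbody w X Y; clear w_ wP seq.
have wE1 n : X n `^ al * Y n `^ be <= k + 1.
  by apply: le_trans (wE n) _; rewrite lerD2l invf_le1 ?ler1n.
have kE n : k <= X n `^ al * Y n `^ be.
  by have := energy_ge _ _ _ _ (wq n) (wX n) (wY n); rewrite powR1 mulr1.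
have [m m0 mX] := @gradient_lower_bound R N p q d N0 (ltW p1) q0 d0.
have Xm n : m <= X n by apply: (mX (w n) (X n) 0 _ (wX n) (wd n)); rewrite wq.
have Yd n : d `^ r <= Y n.
  apply: le_trans (psum_pointwise 0 (wY n)).
  by apply: ge0_ler_powR; rewrite ?nnegrE ?(ltW d0) ?(ltW r0)// ltW.
have dr0 : 0 < d `^ r by rewrite powR_gt0.
have X0 n : 0 < X n by exact: lt_le_trans (Xm n).
have Y0 n : 0 < Y n by exact: lt_le_trans (Yd n).
have [MX XM] : exists M, forall n, X n <= M.
  exists (((k + 1) / (d `^ r) `^ be) `^ al^-1) => n.
  apply: powR_bound => //; first exact: ltW.
  rewrite ler_pdivlMr ?powR_gt0//; apply: le_trans (wE1 n).
  rewrite ler_wpM2l ?powR_ge0//.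
  by apply: ge0_ler_powR; rewrite ?nnegrE ?(ltW dr0) ?(ltW (Y0 n)).
have [MY YM] : exists M, forall n, Y n <= M.
  case: thr => [th|rq].
    have be_gt0 : 0 < be by rewrite -beE divr_gt0 ?subr_gt0.
    exists (((k + 1) / m `^ al) `^ be^-1) => n.
    apply: powR_bound => //; first exact: ltW.
    rewrite ler_pdivlMr ?powR_gt0// mulrC; apply: le_trans (wE1 n).
    rewrite ler_wpM2r ?powR_ge0//.
    by apply: ge0_ler_powR; rewrite ?nnegrE ?(ltW m0) ?(ltW (X0 n)) ?(ltW al0).
  by exists 1 => n; rewrite -lee_fin -wY rq wq.
(* All limits are taken along an ultrafilter finer than [\oo]. *)
have [U [UU subU]] := ultraFilterLemma (eventually_filter).
have [x Xx] := ultra_bounded_cvg (U := U) (f := X) (M := MX)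
  (fun n => ltac:(by rewrite gtr0_norm)).
have [y Yy] := ultra_bounded_cvg (U := U) (f := Y) (M := MY)
  (fun n => ltac:(by rewrite gtr0_norm)).
have w_le1 n z : `|w n z| <= 1.
  rewrite leNgt; apply/negP => wz.
  have := psum_pointwise z (wq n); apply/negP; rewrite -ltNge.
  have <- : 1 `^ q = 1 :> R by rewrite powR1.
  by apply: gt0_ltr_powR => //; rewrite nnegrE.
have lim_ex z : exists l : R, w n z @[n --> U] --> l.
  exact: (ultra_bounded_cvg (U := U) (w_le1^~ z)).
have [u wu] := choice lim_ex.
have x0 : 0 < x by apply: lt_le_trans m0 _; apply: (cvgr_to_ge Xx); exact: nearW.
have y0 : 0 < y by apply: lt_le_trans dr0 _; apply: (cvgr_to_ge Yy); exact: nearW.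
have xy_k : x `^ al * y `^ be = k.
  have XYxy : X n `^ al * Y n `^ be @[n --> U] --> x `^ al * y `^ be.
    by apply: cvgM; apply: cvg_powR => //; rewrite ?ltW// => n; exact: ltW.
  apply/eqP; rewrite eq_le; apply/andP; split.
    have kn : k + n.+1%:R^-1 @[n --> U] --> k + 0.
      apply: cvgD; first exact: cvg_cst.
      by move=> A /cvg_harmonic; exact: subU.
    rewrite -[leRHS]addr0; apply: (ler_cvg_to XYxy kn).
    exact: nearW.
  by apply: (cvgr_to_ge XYxy); exact: nearW.
have grad_wu e : grad (w n) e @[n --> U] --> grad u e.
  case: e => z1 z2; rewrite /grad /=; case: ifP => _; last exact: cvg_cst.
  exact: cvgB.
have [a [A' [a' [ua wuA A'a' [a0 a'0] aa']]]] :=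
  ultra_psumB q1 wu wq (fun=> lexx 1) (cvg_cst (1 : R)).
have [x1 [X' [x2 [ux wuX X'x2 [x10 x20] xx]]]] :=
  ultra_psumB p1 grad_wu wX XM Xx.
have [y1 [Y' [y2 [uy wuY Y'y2 [y10 y20] yy]]]] :=
  ultra_psumB r1 wu wY YM Yy.
have split1 : k * a `^ q^-1 <= x1 `^ al * y1 `^ be by exact: (energy_ge u).
have split2 : k * a' `^ q^-1 <= x2 `^ al * y2 `^ be.
  have L : k * A' n `^ q^-1 @[n --> U] --> k * a' `^ q^-1.
    apply: cvgMl_tmp; apply: cvg_powR => //; first by rewrite invr_ge0 ltW.
    by move=> n; rewrite -lee_fin -wuA psum_ge0.
  have L' : X' n `^ al * Y' n `^ be @[n --> U] --> x2 `^ al * y2 `^ be.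
    apply: cvgM; apply: cvg_powR => //; rewrite ?ltW// => n;
      by rewrite -lee_fin -?wuX -?wuY psum_ge0.
  apply: (ler_cvg_to L L'); apply: nearW => n.
  by apply: (energy_ge (w n \- u)) => //; rewrite gradB.
have a_gt0 : 0 < a.
  have u0 : d <= `|u 0|.
    by apply: (cvgr_to_ge (cvg_norm (wu 0))); apply: nearW => n; exact: ltW.
  apply: lt_le_trans (psum_pointwise 0 ua); rewrite powR_gt0//.
  exact: lt_le_trans u0.
have a1 : a = 1.
  apply/eqP; rewrite eq_le; apply/andP; split; first lra.
  rewrite leNgt; apply/negP => a_lt1.
  have a'E : a' = 1 - a by lra.
  rewrite a'E in split2; rewrite -xy_k xx yy in split1 split2.
  apply: (@powR_prod_split R al be q^-1 a x1 x2 y1 y2 _ _ _ _ _ _ _ _ _ _ split1 split2) => //.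
  - exact: ltW.
  - by rewrite invr_gt0 q0.
  - by rewrite a_gt0.
  - by rewrite -xx.
  - by rewrite -yy.
exists u; split.
- exact: (D0_of_finite p0 q0 ua ux).
- by rewrite /lnorm -/(psum q u) ua a1 poweR1r.
rewrite (energyE theta p0 ux uy) alE beE; congr (_%:E).
apply/eqP; rewrite eq_le; apply/andP; split; last by move: split1; rewrite a1 powR1 mulr1.
rewrite -xy_k; apply: ler_pM; rewrite ?powR_ge0//; apply: ge0_ler_powR;
  rewrite ?nnegrE ?(ltW al0) ?(ltW x0) ?(ltW y0)//; lra.
Qed.

End Main.

Theorem theorem1p5 (R : realType) (N : nat) (p r theta q qstar : R)
  (hN : (1 <= N)%N) (hp : 1 < p) (hr : 1 < r)
  (htheta0 : 0 <= theta) (htheta1 : theta <= 1)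
  (hqstar : qstar^-1 = theta * (p^-1 - N%:R^-1) + (1 - theta) / r)
  (hqstar1 : 1 < qstar) (hq : qstar < q) :
  exists u : 'rV[int]_N -> R,
    [/\ D0 p u, lnorm q u = 1%E & energy p r theta u = Kinf N p r theta q].
Proof.
have p0 : 0 < p by lra. have q0 : 0 < q by lra. have r0 : 0 < r by lra.
have q1 : 1 < q by lra.
have [Dd qd] := @admissible_delta0 R N p q p0 q0.
have K_le (u : 'rV[int]_N -> R) : admissible p q u -> (Kinf N p r theta q <= energy p r theta u)%E.
  by move=> uadm; apply: ereal_inf_lbound; exists u.
have [th0|thpos] := eqVneq theta 0.
  (* Here [r = q* < q], and [lnorm q v = 1] forces [|v| <= 1], hence [lnorm r v >= 1]. *)
  exists (delta0 : 'rV[int]_N -> R); split => //; apply/eqP; rewrite eq_le K_le// andbT.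
  have rq : r < q.
    move: hqstar; rewrite th0 mul0r add0r subr0 div1r => /invr_inj <-; exact: hq.
  apply: le_ereal_inf_tmp => _ [v [_ qv] <-].
  have v1 := lnorm1 q0 qv.
  rewrite /energy th0 !poweRe0 !mul1e subr0 !poweRe1 ?poweR_ge0//.
  rewrite /lnorm -/(psum r _) -/(psum r v) psum_delta0 ?gt_eqF// poweR1r.
  rewrite -[leLHS](poweR1r r^-1); apply: gt0_ler_poweR; rewrite ?invr_ge0 ?(ltW r0)//.
  - by rewrite in_itv /= lee01 leey.
  - by rewrite in_itv /= psum_ge0 leey.
  rewrite -v1; apply: le_esum => x _; rewrite lee_fin.
  have vx : `|v x| <= 1.
    have := psum_pointwise x v1; rewrite !leNgt; apply: contra => vx.
    have <- : 1 `^ q = 1 :> R by rewrite powR1.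
    by apply: gt0_ltr_powR => //; rewrite nnegrE.
  have [->|vx0] := eqVneq (`|v x|) 0; first by rewrite !powR0 ?gt_eqF.
  by apply: ger_powR; [rewrite vx lt_neqAle eq_sym vx0 normr_ge0 | exact: ltW].
have th_gt0 : 0 < theta by rewrite lt_neqAle eq_sym thpos.
have hq' : q^-1 < theta * (p^-1 - N%:R^-1) + (1 - theta) / r.
  by rewrite -hqstar ltf_pV2// posrE; lra.
case EK : (Kinf N p r theta q) => [k||].
- have [th1|thn1] := eqVneq theta 1; last first.
    apply: (minimizer_interior hN hp q1 hr th_gt0 htheta1 _ hq' EK).
    by left; rewrite lt_neqAle thn1.
  (* The energy does not depend on [r]; replacing [r] by [q] makes [lnorm r] finite. *)
  have Er (u : 'rV[int]_N -> R) : energy p r theta u = energy p q theta u :> \bar R.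
    by rewrite /energy th1 subrr !poweRe0.
  have EK' : Kinf N p q theta q = k%:E.
    rewrite -EK /Kinf; congr (ereal_inf _); apply/seteqP.
    by split=> _ [u ? <-]; exists u => //; rewrite Er.
  have hq2 : q^-1 < theta * (p^-1 - N%:R^-1) + (1 - theta) / q.
    by move: hq'; rewrite th1 subrr !mul0r.
  have [u [? ? uE]] := minimizer_interior hN hp q1 q1 th_gt0 htheta1 (or_intror erefl) hq2 EK'.
  by exists u; split => //; rewrite Er uE.
- exists (delta0 : 'rV[int]_N -> R); split => //.
  by apply/eqP; have := K_le delta0 (conj Dd qd); rewrite EK leye_eq.
- have : (0 <= Kinf N p r theta q)%E.
    apply: le_ereal_inf_tmp => _ [u _ <-]; by rewrite mule_ge0// poweR_ge0.
  by rewrite EK.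
Qed.
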